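(* (Squier's theorem) Let $X$ be a convergent left-monomial $1$-polygraph. Let $Y$ be a cellular extension of the free $1$-algebra $\mathcal{A}(X)$ that contains, for every critical branching $(f,g)$ of $X$, with $f:a\to b$ and $g:a\to c$, a $2$-cell $$F: f\star_0 h\Rightarrow g\star_0 k$$ for some positive $1$-cells $h:b\to d$ and $k:c\to d$ of $\mathcal{A}(X)$. Then $Y$ is acyclic.
   Context: Fix a field $\mathbb{K}$; algebras are unital associative $\mathbb{K}$-algebras. A $1$-polygraph $X=\langle X_0\,|\,X_1\rangle$ is a set $X_0$ and a set $X_1$ (of ''$1$-cells'') with two maps $s,t:X_1\to\mathcal{A}(X_0)$ into the free algebra on $X_0$. Monomials are the elements of the free monoid $X_0^*$; $\mathrm{supp}(a)$ is the set of monomials with nonzero coefficient in $a\in\mathcal{A}(X_0)$. $X$ is left-monomial if, for each $\alpha\in X_1$, $s(\alpha)$ is a monomial not belonging to $\mathrm{supp}(t(\alpha))$. The free $1$-algebra $\mathcal{A}(X)$ has as $0$-cells the elements of $\mathcal{A}(X_0)$; its $1$-cells are the elements of the quotient of the $\mathcal{A}(X_0)$-bimodule $(\mathcal{A}(X_0)\otimes\mathbb{K}X_1\otimes\mathcal{A}(X_0))\oplus\mathcal{A}(X_0)$ by the sub-bimodule generated by the elements $(a s(b)+t(a)b-t(a)s(b))-(s(a)b+a t(b)-s(a)t(b))$ for $a,b$ in the first summand, where $s(a\alpha b)=a s(\alpha) b$, $t(a\alpha b)=a t(\alpha) b$, and an element $c$ of the second summand is the identity $1_c$, with source and target $c$.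 Composition of $f:a\to b$ and $g:b\to c$ is $f\star_0 g=f-1_b+g$. A $1$-monomial is a $1$-cell $u\alpha v$ with $u,v$ monomials and $\alpha\in X_1$. Let $X$ be left-monomial. A rewriting step is a $1$-cell $\lambda f+1_a$ with $f$ a $1$-monomial, $\lambda\in\mathbb{K}\setminus\{0\}$ and $a$ a $0$-cell with $s(f)\notin\mathrm{supp}(a)$. A positive $1$-cell is a (possibly empty) composite of rewriting steps. Let $\succ_X$ be the smallest transitive relation on $X_0^*$ that is stable by product and such that $s(\alpha)\succ_X v$ for all $\alpha\in X_1$, $v\in\mathrm{supp}(t(\alpha))$; $X$ terminates if $\succ_X$ is wellfounded. A branching of $X$ is a pair of positive $1$-cells with the same source ($(f,g)$ and $(g,f)$ are not distinguished). $X$ is confluent if, for every branching $(f,g)$, there are positive $1$-cells $h,k$ with $s(h)=t(f)$, $s(k)=t(g)$, $t(h)=t(k)$. $X$ is convergent if it is terminating and confluent. A critical branching is a pair $(f,g)$ of $1$-monomials with the same source such that: $f\neq g$ (not aspherical); $(f,g)$ is not, up to order, of the form $(f'v,ug')$ with $f':u\to a$, $g':v\to b$ $1$-monomials (not Peiffer); and $(f,g)$ cannot be written $u(f',g')v=(uf'v,ug'v)$ with $(f',g')$ a branching and $u,v$ monomials not both equal to $1$. A cellular extension $Y$ of $\mathcal{A}(X)$ is a set $Y$ (of ''$2$-cells'') with two maps $s,t$ from $Y$ to the $1$-cells of $\mathcal{A}(X)$ such that $s(y)$ and $t(y)$ have the same source and the same target. The free $2$-algebra $\mathcal{A}(X)[Y]$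 extends $\mathcal{A}(X)$ with $2$-cells, namely the elements of the quotient of the $\mathcal{A}(X_0)$-bimodule $(\mathcal{A}(X_0)\otimes\mathbb{K}Y\otimes\mathcal{A}(X_0))\oplus\{1\text{-cells of }\mathcal{A}(X)\}$ by the sub-bimodule generated by the elements $(a s_0(b)+t_0(a)b-t_0(a)s_0(b))-(s_0(a)b+a t_0(b)-s_0(a)t_0(b))$ for $a,b$ in the first summand, with $s(ayb)=a s(y) b$, $t(ayb)=a t(y) b$, $s_0,t_0$ the $0$-dimensional source and target, and $s(f)=t(f)=f$ for $f$ in the second summand. $Y$ is acyclic if, for any two $1$-cells $f,g$ of $\mathcal{A}(X)$ with the same source and the same target, there is a $2$-cell $f\Rightarrow g$ in $\mathcal{A}(X)[Y]$. *)

(* Defs.v *)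
From HB Require Import structures.
From mathcomp Require Import all_boot all_algebra finmap.
From mathcomp Require Import boolp.
From mathcomp Require Import monalg.

Set Implicit Arguments.
Unset Strict Implicit.
Unset Printing Implicit Defensive.

Import GRing.Theory.

Local Open Scope ring_scope.
Local Open Scope quotient_scope.

Reserved Notation "a *> m" (at level 40, left associativity).
Reserved Notation "m <* a" (at level 40, left associativity).

(* K acts through lmodType; lactZ.. and ractZ.. say that it acts centrally.   *)
HB.mixin Record Lmodule_isBimodule (K : fieldType) (A : algType K) M
    of GRing.Lmodule K M := {
  lact : A -> M -> M;
  ract : M -> A -> M;
  lact1 : forall m, lact 1 m = m;
  lactA : forall a b m, lact (a * b) m = lact a (lact b m);
  lactDl : forall a b m, lact (a + b) m = lact a m + lact b m;
  lactDr : forall a m n, lact a (m + n) = lact a m + lact a n;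
  lactZl : forall c a m, lact (c *: a) m = c *: lact a m;
  lactZr : forall c a m, lact a (c *: m) = c *: lact a m;
  ract1 : forall m, ract m 1 = m;
  ractA : forall a b m, ract m (a * b) = ract (ract m a) b;
  ractDl : forall a m n, ract (m + n) a = ract m a + ract n a;
  ractDr : forall a b m, ract m (a + b) = ract m a + ract m b;
  ractZl : forall c a m, ract (c *: m) a = c *: ract m a;
  ractZr : forall c a m, ract m (c *: a) = c *: ract m a;
  lractA : forall a b m, ract (lact a m) b = lact a (ract m b)
}.

#[short(type="bimodType")]
HB.structure Definition Bimodule (K : fieldType) (A : algType K) :=
  { M of Lmodule_isBimodule K A M & GRing.Lmodule K M }.

Notation "a *> m" := (lact a m) : ring_scope.
Notation "m <* a" := (ract m a) : ring_scope.

Section BimoduleTheory.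
Context (K : fieldType) (A : algType K) (M : bimodType A).
Implicit Types (a b : A) (m n : M).

Lemma lactr0 a : a *> (0 : M) = 0.
Proof. by apply: (addrI (a *> 0)); rewrite -lactDr !addr0. Qed.

Lemma ract0r a : (0 : M) <* a = 0.
Proof. by apply: (addrI (0 <* a)); rewrite -ractDl !addr0. Qed.

Lemma lactNr a m : a *> (- m) = - (a *> m).
Proof. by apply: (addrI (a *> m)); rewrite -lactDr !subrr lactr0. Qed.

Lemma ractNl a m : (- m) <* a = - (m <* a).
Proof. by apply: (addrI (m <* a)); rewrite -ractDl !subrr ract0r. Qed.

Lemma lactBr a m n : a *> (m - n) = a *> m - a *> n.
Proof. by rewrite lactDr lactNr. Qed.

Lemma ractBl a m n : (m - n) <* a = m <* a - n <* a.
Proof. by rewrite ractDl ractNl. Qed.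

End BimoduleTheory.

Definition bimod_morphism (K : fieldType) (A : algType K) (M N : bimodType A)
    (phi : M -> N) : Prop :=
  [/\ forall x y, phi (x + y) = phi x + phi y,
      forall a x, phi (a *> x) = a *> phi x &
      forall a x, phi (x <* a) = phi x <* a].

Section MorphismTheory.
Context (K : fieldType) (A : algType K) (M N : bimodType A) (phi : M -> N).
Hypothesis phim : bimod_morphism phi.

Lemma bimod_morphD x y : phi (x + y) = phi x + phi y.
Proof. by case: phim. Qed.

Lemma bimod_morph0 : phi 0 = 0.
Proof. by apply: (addrI (phi 0)); rewrite -bimod_morphD !addr0. Qed.

Lemma bimod_morphN x : phi (- x) = - phi x.
Proof.
by apply: (addrI (phi x)); rewrite -bimod_morphD !subrr bimod_morph0.
Qed.

Lemma bimod_morphZ c x : phi (c *: x) = c *: phi x.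
Proof.
by case: phim => _ phil _; rewrite -[x in LHS]lact1 -lactZl phil lactZl lact1.
Qed.

End MorphismTheory.

Lemma bimod_morphism_comp (K : fieldType) (A : algType K) (M N P : bimodType A)
    (psi : N -> P) (phi : M -> N) :
  bimod_morphism psi -> bimod_morphism phi -> bimod_morphism (psi \o phi).
Proof.
move=> [D l r] [D' l' r']; split=> [x y|a x|a x] /=.
- by rewrite D' D.
- by rewrite l' l.
- by rewrite r' r.
Qed.

Section ProdBimodule.
Context (K : fieldType) (A : algType K) (M N : bimodType A).
Implicit Types (a b : A) (m n : M * N).

Definition prod_lact a m : M * N := (a *> m.1, a *> m.2).
Definition prod_ract m a : M * N := (m.1 <* a, m.2 <* a).

Fact prod_lact1 m : prod_lact 1 m = m.
Proof. by case: m => *; rewrite /prod_lact !lact1. Qed.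
Fact prod_lactA a b m : prod_lact (a * b) m = prod_lact a (prod_lact b m).
Proof. by rewrite /prod_lact !lactA. Qed.
Fact prod_lactDl a b m : prod_lact (a + b) m = prod_lact a m + prod_lact b m.
Proof. by rewrite /prod_lact !lactDl. Qed.
Fact prod_lactDr a m n : prod_lact a (m + n) = prod_lact a m + prod_lact a n.
Proof. by rewrite /prod_lact !lactDr. Qed.
Fact prod_lactZl c a m : prod_lact (c *: a) m = c *: prod_lact a m.
Proof. by rewrite /prod_lact !lactZl. Qed.
Fact prod_lactZr c a m : prod_lact a (c *: m) = c *: prod_lact a m.
Proof. by rewrite /prod_lact !lactZr. Qed.
Fact prod_ract1 m : prod_ract m 1 = m.
Proof. by case: m => *; rewrite /prod_ract !ract1. Qed.
Fact prod_ractA a b m : prod_ract m (a * b) = prod_ract (prod_ract m a) b.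
Proof. by rewrite /prod_ract !ractA. Qed.
Fact prod_ractDl a m n : prod_ract (m + n) a = prod_ract m a + prod_ract n a.
Proof. by rewrite /prod_ract !ractDl. Qed.
Fact prod_ractDr a b m : prod_ract m (a + b) = prod_ract m a + prod_ract m b.
Proof. by rewrite /prod_ract !ractDr. Qed.
Fact prod_ractZl c a m : prod_ract (c *: m) a = c *: prod_ract m a.
Proof. by rewrite /prod_ract !ractZl. Qed.
Fact prod_ractZr c a m : prod_ract m (c *: a) = c *: prod_ract m a.
Proof. by rewrite /prod_ract !ractZr. Qed.
Fact prod_lractA a b m : prod_ract (prod_lact a m) b = prod_lact a (prod_ract m b).
Proof. by rewrite /prod_ract /prod_lact /= !lractA. Qed.

HB.instance Definition _ := Lmodule_isBimodule.Build K A (M * N)%type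
  prod_lact1 prod_lactA prod_lactDl prod_lactDr prod_lactZl prod_lactZr
  prod_ract1 prod_ractA prod_ractDl prod_ractDr prod_ractZl prod_ractZr
  prod_lractA.

End ProdBimodule.

Section QuotientBimodule.
Context (K : fieldType) (A : algType K) (M : bimodType A) (P : M -> Prop).

Inductive subbimod_gen : M -> Prop :=
| Subbimod_gen x of P x : subbimod_gen x
| Subbimod_0 : subbimod_gen 0
| Subbimod_D x y of subbimod_gen x & subbimod_gen y : subbimod_gen (x + y)
| Subbimod_l a x of subbimod_gen x : subbimod_gen (a *> x)
| Subbimod_r a x of subbimod_gen x : subbimod_gen (x <* a).

Definition subbimod_pred : {pred M} := fun x => `[< subbimod_gen x >].

Fact subbimod_zmod_closed : zmod_closed subbimod_pred.
Proof.
split=> [|x y /asboolP Sx /asboolP Sy]; apply/asboolP; first exact: Subbimod_0.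
apply: Subbimod_D => //.
have -> : - y = (- 1) *> y by rewrite -[X in _ = X *> _]scaleN1r lactZl lact1 scaleN1r.
exact: Subbimod_l.
Qed.

HB.instance Definition _ :=
  GRing.isZmodClosed.Build M subbimod_pred subbimod_zmod_closed.

Definition bquot : Type := Quotient.quot subbimod_pred.
HB.instance Definition _ := GRing.Zmodule.on bquot.

End QuotientBimodule.

(* The projection onto the quotient and a choice of representatives.          *)
HB.lock Definition bproj (K : fieldType) (A : algType K) (M : bimodType A)
  (P : M -> Prop) (x : M) : bquot P := \pi_(Quotient.quot (subbimod_pred P)) x.

HB.lock Definition brepr (K : fieldType) (A : algType K) (M : bimodType A)
  (P : M -> Prop) (q : bquot P) : M := repr (q : Quotient.quot (subbimod_pred P)).

Section QuotientBimoduleTheory.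
Context (K : fieldType) (A : algType K) (M : bimodType A) (P : M -> Prop).
Local Notation bquot := (bquot P).
Local Notation bproj := (@bproj K A M P).
Local Notation brepr := (@brepr K A M P).
Local Notation subbimod_gen := (subbimod_gen P).

Lemma breprK q : bproj (brepr q) = q.
Proof. by rewrite bproj.unlock brepr.unlock reprK. Qed.

Lemma bproj_eqP x y : bproj x = bproj y <-> subbimod_gen (x - y).
Proof.
rewrite bproj.unlock; split=> [/eqP|H].
  by rewrite -Quotient.idealrBE => /asboolP.
by apply/eqP; rewrite -Quotient.idealrBE; apply/asboolP.
Qed.

Lemma bproj_brepr x : subbimod_gen (brepr (bproj x) - x).
Proof. by apply/bproj_eqP; rewrite breprK. Qed.

Lemma bprojD x y : bproj (x + y) = bproj x + bproj y.
Proof.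
rewrite bproj.unlock.
exact: (raddfD (\pi_(Quotient.quot (subbimod_pred P)))).
Qed.

Definition bquot_scale (c : K) (q : bquot) : bquot := bproj (c *: brepr q).
Definition bquot_lact (a : A) (q : bquot) : bquot := bproj (a *> brepr q).
Definition bquot_ract (q : bquot) (a : A) : bquot := bproj (brepr q <* a).

Lemma bquot_scaleE c x : bquot_scale c (bproj x) = bproj (c *: x).
Proof.
apply/bproj_eqP; rewrite -scalerBr -[_ - _]lact1 -lactZl.
exact/Subbimod_l/bproj_brepr.
Qed.
Lemma bquot_lactE a x : bquot_lact a (bproj x) = bproj (a *> x).
Proof. by apply/bproj_eqP; rewrite -lactBr; apply/Subbimod_l/bproj_brepr. Qed.
Lemma bquot_ractE a x : bquot_ract (bproj x) a = bproj (x <* a).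
Proof. by apply/bproj_eqP; rewrite -ractBl; apply/Subbimod_r/bproj_brepr. Qed.

Let bquotE := (bquot_scaleE, bquot_lactE, bquot_ractE).

Fact bquot_scaleA c d q : bquot_scale c (bquot_scale d q) = bquot_scale (c * d) q.
Proof. by rewrite -[q]breprK !bquotE scalerA. Qed.
Fact bquot_scale1 : left_id 1 bquot_scale.
Proof. by move=> q; rewrite -[q]breprK !bquotE scale1r. Qed.
Fact bquot_scaleDr : right_distributive bquot_scale +%R.
Proof.
by move=> c p q; rewrite -[p]breprK -[q]breprK -bprojD !bquotE -bprojD scalerDr.
Qed.
Fact bquot_scaleDl q : {morph bquot_scale^~ q : c d / c + d}.
Proof. by move=> c d; rewrite -[q]breprK !bquotE -bprojD scalerDl. Qed.

HB.instance Definition _ := GRing.Zmodule_isLmodule.Build K bquot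
  bquot_scaleA bquot_scale1 bquot_scaleDr bquot_scaleDl.

Lemma bprojZ c x : bproj (c *: x) = c *: bproj x.
Proof. by rewrite -bquot_scaleE. Qed.

Fact bquot_lact1 q : bquot_lact 1 q = q.
Proof. by rewrite -[q]breprK !bquotE lact1. Qed.
Fact bquot_lactA a b q : bquot_lact (a * b) q = bquot_lact a (bquot_lact b q).
Proof. by rewrite -[q]breprK !bquotE lactA. Qed.
Fact bquot_lactDl a b q : bquot_lact (a + b) q = bquot_lact a q + bquot_lact b q.
Proof. by rewrite -[q]breprK !bquotE lactDl bprojD. Qed.
Fact bquot_lactDr a p q : bquot_lact a (p + q) = bquot_lact a p + bquot_lact a q.
Proof.
by rewrite -[p]breprK -[q]breprK -bprojD !bquotE lactDr bprojD.
Qed.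
Fact bquot_lactZl c a q : bquot_lact (c *: a) q = c *: bquot_lact a q.
Proof. by rewrite -[q]breprK !bquotE lactZl bprojZ. Qed.
Fact bquot_lactZr c a q : bquot_lact a (c *: q) = c *: bquot_lact a q.
Proof. by rewrite -[q]breprK -bprojZ !bquotE lactZr bprojZ. Qed.
Fact bquot_ract1 q : bquot_ract q 1 = q.
Proof. by rewrite -[q]breprK !bquotE ract1. Qed.
Fact bquot_ractA a b q : bquot_ract q (a * b) = bquot_ract (bquot_ract q a) b.
Proof. by rewrite -[q]breprK !bquotE ractA. Qed.
Fact bquot_ractDl a p q : bquot_ract (p + q) a = bquot_ract p a + bquot_ract q a.
Proof.
by rewrite -[p]breprK -[q]breprK -bprojD !bquotE ractDl bprojD.
Qed.
Fact bquot_ractDr a b q : bquot_ract q (a + b) = bquot_ract q a + bquot_ract q b.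
Proof. by rewrite -[q]breprK !bquotE ractDr bprojD. Qed.
Fact bquot_ractZl c a q : bquot_ract (c *: q) a = c *: bquot_ract q a.
Proof. by rewrite -[q]breprK -bprojZ !bquotE ractZl bprojZ. Qed.
Fact bquot_ractZr c a q : bquot_ract q (c *: a) = c *: bquot_ract q a.
Proof. by rewrite -[q]breprK !bquotE ractZr bprojZ. Qed.
Fact bquot_lractA a b q :
  bquot_ract (bquot_lact a q) b = bquot_lact a (bquot_ract q b).
Proof. by rewrite -[q]breprK !bquotE lractA. Qed.

HB.instance Definition _ := Lmodule_isBimodule.Build K A bquot
  bquot_lact1 bquot_lactA bquot_lactDl bquot_lactDr bquot_lactZl bquot_lactZr
  bquot_ract1 bquot_ractA bquot_ractDl bquot_ractDr bquot_ractZl bquot_ractZr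
  bquot_lractA.

Lemma bproj_lact a x : bproj (a *> x) = a *> bproj x.
Proof. by rewrite -bquot_lactE. Qed.
Lemma bproj_ract a x : bproj (x <* a) = bproj x <* a.
Proof. by rewrite -bquot_ractE. Qed.

(* The map induced on the quotient by phi; it is computed on representatives, *)
(* hence meaningful when phi is a morphism that vanishes on P (blift_bproj).  *)
Definition blift (N : bimodType A) (phi : M -> N) (q : bquot) : N :=
  phi (brepr q).

Lemma blift_bproj (N : bimodType A) (phi : M -> N) x :
  bimod_morphism phi -> (forall y, P y -> phi y = 0) ->
  blift phi (bproj x) = phi x.
Proof.
move=> [phiD phil phir] phiP.
have phi0 : phi 0 = 0 by apply: (addrI (phi 0)); rewrite -phiD !addr0.
have phiS z : subbimod_gen z -> phi z = 0.
  elim=> {z} [z /phiP//|//|y z _ fy _ fz|a z _ fz|a z _ fz].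
  - by rewrite phiD fy fz addr0.
  - by rewrite phil fz lactr0.
  - by rewrite phir fz ract0r.
by rewrite /blift -[in LHS](subrK x (brepr _)) phiD (phiS _ (bproj_brepr x)) add0r.
Qed.

Lemma blift_morphism (N : bimodType A) (phi : M -> N) :
  bimod_morphism phi -> (forall y, P y -> phi y = 0) ->
  bimod_morphism (blift phi).
Proof.
move=> phim phiP; have liftE x := blift_bproj x phim phiP.
case: (phim) => [phiD phil phir]; split=> [p q|a q|a q].
- by rewrite -[p]breprK -[q]breprK -bprojD !liftE phiD.
- by rewrite -[q]breprK -bproj_lact !liftE phil.
- by rewrite -[q]breprK -bproj_ract !liftE phir.
Qed.

End QuotientBimoduleTheory.

Definition free_lmod (K : fieldType) (T : choiceType) : Type := {malg K[T]}.

(* Scaling, product and linear extension are sealed so that unification does  *)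
(* not unfold the finitely supported functions below them.                    *)
HB.lock Definition free_scale (K : fieldType) (T : choiceType) (c : K)
  (m : free_lmod K T) : free_lmod K T := fgscale c m.

HB.lock Definition fbasis (K : fieldType) (T : choiceType) (k : T) :
  free_lmod K T := << k >>.

HB.lock Definition free_mul (K : fieldType) (M : monomType)
  (a b : free_lmod K M) : free_lmod K M := fgmul a b.

Section FreeLmod.
Context (K : fieldType) (T : choiceType).
Local Notation F := (free_lmod K T).

HB.instance Definition _ := GRing.Zmodule.copy F {malg K[T]}.

Fact free_scaleA c d (m : F) :
  free_scale c (free_scale d m) = free_scale (c * d) m.
Proof. by rewrite unlock; exact: fgscaleA. Qed.
Fact free_scale1 : left_id 1 (@free_scale K T).
Proof. by move=> m; rewrite unlock; exact: fgscale1r. Qed.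
Fact free_scaleDr : right_distributive (@free_scale K T) +%R.
Proof. by move=> c m n; rewrite unlock; exact: fgscaleDr. Qed.
Fact free_scaleDl (m : F) : {morph (@free_scale K T)^~ m : c d / c + d}.
Proof. by move=> c d; rewrite unlock; exact: fgscaleDl. Qed.

HB.instance Definition _ := GRing.Zmodule_isLmodule.Build K F
  free_scaleA free_scale1 free_scaleDr free_scaleDl.

Lemma fbasisE k : fbasis K k = << k >> :> F.
Proof. by rewrite unlock. Qed.

Lemma free_scaleE (c : K) (m : F) : c *: m = fgscale c m.
Proof. by rewrite -[LHS]/(free_scale c m) unlock. Qed.

Lemma mcoeff_free_scale (c : K) (m : F) k : (c *: m)@_k = c * m@_k.
Proof. by rewrite free_scaleE fgscaleE. Qed.

Lemma scale_fbasis c k : c *: fbasis K k = << c *g k >> :> F.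
Proof.
by apply/malgP=> k'; rewrite mcoeff_free_scale fbasisE !mcoeffU mulr_natr.
Qed.

Lemma free_lmod_ind (P : F -> Prop) :
  (forall k, P (fbasis K k)) -> (forall m n, P m -> P n -> P (m + n)) ->
  (forall c m, P m -> P (c *: m)) -> P 0 -> forall m, P m.
Proof.
move=> PU PD PZ P0 m; rewrite [m]monalgE.
elim/big_rec: _ => // k n _ Pn; apply: (PD) => //.
by rewrite -scale_fbasis; apply: PZ.
Qed.

End FreeLmod.

(* The K-linear extension of h : T -> V to the free vector space on T. *)
HB.lock Definition linext (K : fieldType) (T : choiceType) (V : lmodType K)
  (h : T -> V) (m : free_lmod K T) : V := \sum_(k <- msupp m) m@_k *: h k.

Section LinearExtension.
Context (K : fieldType) (T : choiceType) (V : lmodType K).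
Implicit Types (h : T -> V) (m n : free_lmod K T).

Lemma linextEw (d : {fset T}) h m : (msupp m `<=` d)%fset ->
  linext h m = \sum_(k <- d) m@_k *: h k.
Proof.
move=> le; rewrite [linext]unlock (big_fset_incl _ le) //.
by move=> k _ /mcoeff_outdom ->; rewrite scale0r.
Qed.

Lemma linextD h m n : linext h (m + n) = linext h m + linext h n.
Proof.
rewrite (linextEw _ (msuppD_le m n)) (linextEw h (fsubsetUl (msupp m) (msupp n))).
rewrite (linextEw h (fsubsetUr (msupp m) (msupp n))) -big_split /=.
by apply: eq_bigr => k _; rewrite -scalerDl -mcoeffD.
Qed.

Lemma linextZ h c m : linext h (c *: m) = c *: linext h m.
Proof.
have le : (msupp (c *: m) `<=` msupp m)%fset.
  by rewrite free_scaleE; exact: msuppZ_le.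
rewrite (linextEw _ le) (linextEw _ (fsubset_refl _)) scaler_sumr.
by apply: eq_bigr => k _; rewrite mcoeff_free_scale scalerA.
Qed.

Lemma linext0 h : linext h 0 = 0.
Proof. by rewrite -[in LHS](scale0r (0 : free_lmod K T)) linextZ scale0r. Qed.

Lemma linextU h k : linext h (fbasis K k) = h k.
Proof.
by rewrite fbasisE (linextEw _ msuppU_le) big_seq_fset1 mcoeffUU scale1r.
Qed.

Lemma eq_linext h1 h2 m : h1 =1 h2 -> linext h1 m = linext h2 m.
Proof. by rewrite unlock => eqh; apply: eq_bigr => k _; rewrite eqh. Qed.

Lemma linextDf h1 h2 m :
  linext (fun k => h1 k + h2 k) m = linext h1 m + linext h2 m.
Proof.
by rewrite unlock -big_split; apply: eq_bigr => k _; rewrite scalerDr.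
Qed.

Lemma linextZf c h m : linext (fun k => c *: h k) m = c *: linext h m.
Proof.
rewrite unlock scaler_sumr.
by apply: eq_bigr => k _; rewrite !scalerA mulrC.
Qed.

End LinearExtension.

Definition free_alg (K : fieldType) (X0 : choiceType) : Type :=
  free_lmod K {fmonom X0}.

(* A (x) K T (x) A with A = free_alg K X0: as A has basis the monomials, it   *)
(* is the K-vector space on the triples (u, x, v), read u (x) x (x) v.        *)
Definition free_bimod (K : fieldType) (X0 T : choiceType) : Type :=
  free_lmod K ({fmonom X0} * T * {fmonom X0})%type.

Section FreeAlgebra.
Context (K : fieldType) (X0 : choiceType).

HB.instance Definition _ := GRing.Lmodule.on (free_alg K X0).

Definition mon (u : {fmonom X0}) : free_alg K X0 := fbasis K u.

Let fmul : free_alg K X0 -> free_alg K X0 -> free_alg K X0 :=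
  @free_mul K {fmonom X0}.

Fact free_mulA : associative fmul.
Proof. by move=> a b c; rewrite /fmul unlock; exact: fgmulA. Qed.
Fact free_mul1l : left_id (mon mone) fmul.
Proof. by move=> a; rewrite /fmul /mon fbasisE unlock; exact: fgmul1g. Qed.
Fact free_mul1r : right_id (mon mone) fmul.
Proof. by move=> a; rewrite /fmul /mon fbasisE unlock; exact: fgmulg1. Qed.
Fact free_mulDl : left_distributive fmul +%R.
Proof. by move=> a b c; rewrite /fmul unlock; exact: fgmulgDl. Qed.
Fact free_mulDr : right_distributive fmul +%R.
Proof. by move=> a b c; rewrite /fmul unlock; exact: fgmulgDr. Qed.
Fact free_mul1_neq0 : mon mone != 0.
Proof. by rewrite /mon fbasisE; exact: fgoner_eq0. Qed.

HB.instance Definition _ := GRing.Zmodule_isNzRing.Build (free_alg K X0)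
  free_mulA free_mul1l free_mul1r free_mulDl free_mulDr free_mul1_neq0.

Fact free_alg_scaleAl (c : K) (a b : free_alg K X0) : c *: (a * b) = c *: a * b.
Proof.
rewrite -[a * b]/(free_mul a b) -[RHS]/(free_mul (c *: a) b) !free_scaleE unlock.
exact: fgscaleAl.
Qed.

HB.instance Definition _ :=
  GRing.Lmodule_isLalgebra.Build K (free_alg K X0) free_alg_scaleAl.

Definition supp (a : free_alg K X0) : {fset {fmonom X0}} := msupp a.

Lemma mon1 : mon mone = 1.
Proof. by []. Qed.

Lemma monM u v : mon (mmul u v) = mon u * mon v.
Proof.
by rewrite -[RHS]/(free_mul (mon u) (mon v)) unlock /mon !fbasisE
  [RHS]fgmulUU mulr1.
Qed.

Lemma free_alg_ind (P : free_alg K X0 -> Prop) :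
  (forall u, P (mon u)) -> (forall m n, P m -> P n -> P (m + n)) ->
  (forall c m, P m -> P (c *: m)) -> P 0 -> forall m, P m.
Proof. exact: free_lmod_ind. Qed.

Fact free_alg_scaleAr (c : K) (a b : free_alg K X0) :
  c *: (a * b) = a * (c *: b).
Proof.
suff central : a * (c *: 1) = c *: a.
  by rewrite -[b in RHS]mul1r [in RHS]scalerAl mulrA central scalerAl.
elim/free_alg_ind: a => [u|a a' IH IH'|d a IH|].
- rewrite -mon1 scale_fbasis -[LHS]/(free_mul (mon u) _).
  by rewrite /mon scale_fbasis fbasisE unlock [LHS]fgmulUU mul1r mulm1.
- by rewrite mulrDl scalerDr IH IH'.
- by rewrite -scalerAl IH !scalerA mulrC.
- by rewrite mul0r scaler0.
Qed.

HB.instance Definition _ :=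
  GRing.Lalgebra_isAlgebra.Build K (free_alg K X0) free_alg_scaleAr.

HB.instance Definition _ := Lmodule_isBimodule.Build K (free_alg K X0)
  (free_alg K X0) (@mul1r _) (fun a b m => esym (mulrA a b m))
  (fun a b m => mulrDl a b m) (fun a m n => mulrDr a m n)
  (fun c a m => esym (scalerAl c a m)) (fun c a m => esym (scalerAr c a m))
  (@mulr1 _) (fun a b m => mulrA m a b)
  (fun a m n => mulrDl m n a) (fun a b m => mulrDr m a b)
  (fun c a m => esym (scalerAl c m a)) (fun c a m => esym (scalerAr c m a))
  (fun a b m => esym (mulrA a m b)).

End FreeAlgebra.

HB.instance Definition _ (K : fieldType) (X0 T : choiceType) :=
  GRing.Lmodule.on (free_bimod K X0 T).

Definition fgen (K : fieldType) (X0 T : choiceType) (u : {fmonom X0}) (x : T)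
  (v : {fmonom X0}) : free_bimod K X0 T := fbasis K (u, x, v).

(* Left and right multiplication by a monomial. *)
Definition fmonl (K : fieldType) (X0 T : choiceType) (u : {fmonom X0}) :
    free_bimod K X0 T -> free_bimod K X0 T :=
  linext (fun k => fgen K (mmul u k.1.1) k.1.2 k.2).
Definition fmonr (K : fieldType) (X0 T : choiceType) (v : {fmonom X0}) :
    free_bimod K X0 T -> free_bimod K X0 T :=
  linext (fun k => fgen K k.1.1 k.1.2 (mmul k.2 v)).

HB.lock Definition free_lact (K : fieldType) (X0 T : choiceType)
  (a : free_alg K X0) (m : free_bimod K X0 T) : free_bimod K X0 T :=
  linext (fun u => fmonl u m) a.
HB.lock Definition free_ract (K : fieldType) (X0 T : choiceType)
  (m : free_bimod K X0 T) (a : free_alg K X0) : free_bimod K X0 T :=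
  linext (fun v => fmonr v m) a.

Section FreeBimodule.
Context (K : fieldType) (X0 T : choiceType).
Local Notation A := (free_alg K X0).
Local Notation F := (free_bimod K X0 T).
Local Notation fgen := (@fgen K X0 T).
Local Notation mon := (@mon K X0).
Implicit Types (a b : A) (m n : F).

Fact fmonlD u m n : fmonl u (m + n) = fmonl u m + fmonl u n.
Proof. exact: linextD. Qed.
Fact fmonlZ u c m : fmonl u (c *: m) = c *: fmonl u m.
Proof. exact: linextZ. Qed.
Fact fmonrD u m n : fmonr u (m + n) = fmonr u m + fmonr u n.
Proof. exact: linextD. Qed.
Fact fmonrZ u c m : fmonr u (c *: m) = c *: fmonr u m.
Proof. exact: linextZ. Qed.

Lemma free_bimod_ind (P : F -> Prop) :
  (forall u x v, P (fgen u x v)) -> (forall m n, P m -> P n -> P (m + n)) ->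
  (forall c m, P m -> P (c *: m)) -> P 0 -> forall m, P m.
Proof. by move=> PU; apply: free_lmod_ind => -[[u x] v]; apply: PU. Qed.

Lemma free_lactE u w x v : free_lact (mon u) (fgen w x v) = fgen (mmul u w) x v.
Proof. by rewrite unlock linextU; exact: linextU. Qed.
Lemma free_ractE u w x v : free_ract (fgen w x v) (mon u) = fgen w x (mmul v u).
Proof. by rewrite unlock linextU; exact: linextU. Qed.

Fact free_lactDl a b m : free_lact (a + b) m = free_lact a m + free_lact b m.
Proof. by rewrite unlock; exact: linextD. Qed.
Fact free_lactZl c a m : free_lact (c *: a) m = c *: free_lact a m.
Proof. by rewrite unlock; exact: linextZ. Qed.
Fact free_lactDr a m n : free_lact a (m + n) = free_lact a m + free_lact a n.
Proof.
rewrite unlock; apply: etrans (eq_linext a (fun u => fmonlD u m n)) _; exact: linextDf.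
Qed.
Fact free_lactZr c a m : free_lact a (c *: m) = c *: free_lact a m.
Proof.
rewrite unlock; apply: etrans (eq_linext a (fun u => fmonlZ u c m)) _; exact: linextZf.
Qed.
Fact free_ractDr a b m : free_ract m (a + b) = free_ract m a + free_ract m b.
Proof. by rewrite unlock; exact: linextD. Qed.
Fact free_ractZr c a m : free_ract m (c *: a) = c *: free_ract m a.
Proof. by rewrite unlock; exact: linextZ. Qed.
Fact free_ractDl a m n : free_ract (m + n) a = free_ract m a + free_ract n a.
Proof.
rewrite unlock; apply: etrans (eq_linext a (fun u => fmonrD u m n)) _; exact: linextDf.
Qed.
Fact free_ractZl c a m : free_ract (c *: m) a = c *: free_ract m a.
Proof.
rewrite unlock; apply: etrans (eq_linext a (fun u => fmonrZ u c m)) _; exact: linextZf.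
Qed.

Let free_lact0l m : free_lact 0 m = 0.
Proof. by rewrite -(scale0r (0 : A)) free_lactZl !scale0r. Qed.
Let free_lact0r a : free_lact a 0 = 0 :> F.
Proof. by rewrite -(scale0r (0 : F)) free_lactZr !scale0r. Qed.
Let free_ract0l a : free_ract 0 a = 0 :> F.
Proof. by rewrite -(scale0r (0 : F)) free_ractZl !scale0r. Qed.
Let free_ract0r m : free_ract m 0 = 0.
Proof. by rewrite -(scale0r (0 : A)) free_ractZr !scale0r. Qed.

Fact free_lact1 m : free_lact 1 m = m.
Proof.
elim/free_bimod_ind: m => [u x v|m n IHm IHn|c m IH|].
- by rewrite -mon1 free_lactE mul1m.
- by rewrite free_lactDr IHm IHn.
- by rewrite free_lactZr IH.
- by rewrite free_lact0r.
Qed.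

Fact free_ract1 m : free_ract m 1 = m.
Proof.
elim/free_bimod_ind: m => [u x v|m n IHm IHn|c m IH|].
- by rewrite -mon1 free_ractE mulm1.
- by rewrite free_ractDl IHm IHn.
- by rewrite free_ractZl IH.
- by rewrite free_ract0l.
Qed.

Fact free_lactA a b m : free_lact (a * b) m = free_lact a (free_lact b m).
Proof.
elim/free_bimod_ind: m => [w x v|m n IHm IHn|c m IH|]; last 1 first.
- by rewrite !free_lact0r.
- elim/free_alg_ind: a => [u|a a' IH IH'|c a IH|]; last 1 first.
  + by rewrite mul0r !free_lact0l.
  + elim/free_alg_ind: b => [u'|b b' IH IH'|c b IH|].
    * by rewrite -monM !free_lactE mulmA.
    * by rewrite mulrDr !free_lactDl IH IH' free_lactDr.
    * by rewrite -scalerAr !free_lactZl IH free_lactZr.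
    * by rewrite mulr0 !free_lact0l free_lact0r.
  + by rewrite mulrDl !free_lactDl IH IH'.
  + by rewrite -scalerAl !free_lactZl IH.
- by rewrite !free_lactDr IHm IHn.
- by rewrite !free_lactZr IH.
Qed.

Fact free_ractA a b m : free_ract m (a * b) = free_ract (free_ract m a) b.
Proof.
elim/free_bimod_ind: m => [w x v|m n IHm IHn|c m IH|]; last 1 first.
- by rewrite !free_ract0l.
- elim/free_alg_ind: a => [u|a a' IH IH'|c a IH|]; last 1 first.
  + by rewrite mul0r !free_ract0r free_ract0l.
  + elim/free_alg_ind: b => [u'|b b' IH IH'|c b IH|].
    * by rewrite -monM !free_ractE mulmA.
    * by rewrite mulrDr !free_ractDr IH IH'.
    * by rewrite -scalerAr !free_ractZr IH.
    * by rewrite mulr0 !free_ract0r.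
  + by rewrite mulrDl !free_ractDr IH IH' free_ractDl.
  + by rewrite -scalerAl !free_ractZr IH free_ractZl.
- by rewrite !free_ractDl IHm IHn.
- by rewrite !free_ractZl IH.
Qed.

Fact free_lractA a b m : free_ract (free_lact a m) b = free_lact a (free_ract m b).
Proof.
elim/free_bimod_ind: m => [w x v|m n IHm IHn|c m IH|]; last 1 first.
- by rewrite free_lact0r !free_ract0l free_lact0r.
- elim/free_alg_ind: a => [u|a a' IH IH'|c a IH|]; last 1 first.
  + by rewrite !free_lact0l free_ract0l.
  + elim/free_alg_ind: b => [u'|b b' IH IH'|c b IH|].
    * by rewrite free_lactE !free_ractE free_lactE.
    * by rewrite !free_ractDr IH IH' free_lactDr.
    * by rewrite !free_ractZr IH free_lactZr.
    * by rewrite !free_ract0r free_lact0r.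
  + by rewrite !free_lactDl free_ractDl IH IH'.
  + by rewrite !free_lactZl free_ractZl IH.
- by rewrite free_lactDr !free_ractDl IHm IHn free_lactDr.
- by rewrite free_lactZr !free_ractZl IH free_lactZr.
Qed.

HB.instance Definition _ := Lmodule_isBimodule.Build K A F
  free_lact1 free_lactA free_lactDl free_lactDr free_lactZl free_lactZr
  free_ract1 free_ractA free_ractDl free_ractDr free_ractZl free_ractZr
  free_lractA.

End FreeBimodule.

(* The bimodule map that sends each generator x to h x. *)
HB.lock Definition bimod_ext (K : fieldType) (X0 T : choiceType)
  (M : bimodType (free_alg K X0)) (h : T -> M) (m : free_bimod K X0 T) : M :=
  linext (fun k => mon K k.1.1 *> h k.1.2 <* mon K k.2) m.

Section BimoduleExtension.
Context (K : fieldType) (X0 T : choiceType).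
Local Notation A := (free_alg K X0).
Local Notation F := (free_bimod K X0 T).
Local Notation fgen := (@fgen K X0 T).
Local Notation mon := (@mon K X0).

Lemma bimod_extE (M : bimodType A) (h : T -> M) u x v :
  bimod_ext h (fgen u x v) = mon u *> h x <* mon v.
Proof. by rewrite unlock; exact: linextU. Qed.

Lemma bimod_ext_morphism (M : bimodType A) (h : T -> M) :
  bimod_morphism (bimod_ext h).
Proof.
have extD x y : bimod_ext h (x + y) = bimod_ext h x + bimod_ext h y.
  by rewrite unlock; exact: linextD.
have extZ c x : bimod_ext h (c *: x) = c *: bimod_ext h x.
  by rewrite unlock; exact: linextZ.
have ext0 : bimod_ext h 0 = 0 by rewrite -(scale0r (0 : F)) extZ !scale0r.
have lact0 (N : bimodType A) (x : N) : (0 : A) *> x = 0.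
  by rewrite -(scale0r (0 : A)) lactZl !scale0r.
have ract0 (N : bimodType A) (x : N) : x <* (0 : A) = 0.
  by rewrite -(scale0r (0 : A)) ractZr !scale0r.
split=> // a x.
- elim/free_bimod_ind: x => [w x v|m n IHm IHn|c m IH|]; last 1 first.
  + by rewrite !(lactr0, ext0).
  + elim/free_alg_ind: a => [u|a a' IH IH'|c a IH|].
    * by rewrite [_ *> fgen _ _ _]free_lactE !bimod_extE monM lactA !lractA.
    * by rewrite !lactDl extD IH IH'.
    * by rewrite !lactZl extZ IH.
    * by rewrite !lact0 ext0.
  + by rewrite !(lactDr, extD) IHm IHn.
  + by rewrite lactZr !extZ IH lactZr.
- elim/free_bimod_ind: x => [w x v|m n IHm IHn|c m IH|]; last 1 first.
  + by rewrite !(ract0r, ext0).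
  + elim/free_alg_ind: a => [u|a a' IH IH'|c a IH|].
    * by rewrite [_ <* mon u]free_ractE !bimod_extE monM ractA.
    * by rewrite !ractDr extD IH IH'.
    * by rewrite !ractZr extZ IH.
    * by rewrite !ract0 ext0.
  + by rewrite !(ractDl, extD) IHm IHn.
  + by rewrite ractZl !extZ IH ractZl.
Qed.

Lemma bimod_morphism_ext (M : bimodType A) (phi psi : F -> M) :
  bimod_morphism phi -> bimod_morphism psi ->
  (forall x, phi (fgen mone x mone) = psi (fgen mone x mone)) -> phi =1 psi.
Proof.
move=> phim psim eqg m.
case: (phim) => phiD phil phir; case: (psim) => psiD psil psir.
elim/free_bimod_ind: m => [u x v|m n IHm IHn|c m IH|].
- suff -> : fgen u x v = mon u *> fgen mone x mone <* mon v.
    by rewrite phir phil psir psil eqg.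
  rewrite -[RHS]/(free_ract (free_lact (mon u) (fgen mone x mone)) (mon v)).
  by rewrite free_lactE free_ractE mulm1 mul1m.
- by rewrite phiD psiD IHm IHn.
- by rewrite !bimod_morphZ // IH.
- by rewrite !bimod_morph0.
Qed.

End BimoduleExtension.

Section FreeHigherAlgebra.
Context (K : fieldType) (A : algType K) (E C : bimodType A).
Context (s0 t0 : E -> A) (id0 : A -> C).

(* C is the bimodule of cells one dimension below, with id0 giving identity   *)
(* cells, and s0, t0 are the 0-dimensional source and target of the new cells *)
(* E.  The relation holds in E + C.                                           *)
Variant exchange : E * C -> Prop :=
  Exchange (a b : E) : exchange
    ((a <* s0 b + t0 a *> b, - id0 (t0 a * s0 b))
     - (s0 a *> b + a <* t0 b, - id0 (s0 a * t0 b))).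

Definition free_cells : Type := bquot exchange.
HB.instance Definition _ := Bimodule.on free_cells.

End FreeHigherAlgebra.

(* Sets of generating cells are choiceTypes, as {malg _[_]} requires; with    *)
(* the choice axioms of boolp, any type can be given that structure.          *)
Record polygraph1 (K : fieldType) := Polygraph1 {
  gen0 : choiceType;
  gen1 : choiceType;
  gsrc : gen1 -> free_alg K gen0;
  gtgt : gen1 -> free_alg K gen0
}.

Section OneCells.
Context (K : fieldType) (X : polygraph1 K).
Local Notation A := (free_alg K (gen0 X)).
Local Notation E := (free_bimod K (gen0 X) (gen1 X)).
Local Notation ssum := (bimod_ext (@gsrc K X)).
Local Notation tsum := (bimod_ext (@gtgt K X)).

(* The 1-cells of A(X): here the cells below are those of A itself.           *)
Definition cell1 : Type := free_cells ssum tsum (@id A).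
HB.instance Definition _ := Bimodule.on cell1.

Definition src1 : cell1 -> A := blift (fun x => ssum x.1 + x.2).
Definition tgt1 : cell1 -> A := blift (fun x => tsum x.1 + x.2).
Definition id1 (a : A) : cell1 := bproj _ (0, a).
Definition mono1 (u : {fmonom gen0 X}) (x : gen1 X) v : cell1 :=
  bproj _ (fgen K u x v, 0).

(* The composite f *_0 g; meaningful when tgt1 f = src1 g. *)
Definition comp1 (f g : cell1) : cell1 := f - id1 (tgt1 f) + g.

Let src1_morphism : bimod_morphism (fun x : E * A => ssum x.1 + x.2).
Proof.
have [D l r] := bimod_ext_morphism (@gsrc K X).
split=> [x y|a x|a x] /=.
- by rewrite D addrACA.
- by rewrite l lactDr.
- by rewrite r ractDl.
Qed.

Let tgt1_morphism : bimod_morphism (fun x : E * A => tsum x.1 + x.2).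
Proof.
have [D l r] := bimod_ext_morphism (@gtgt K X).
split=> [x y|a x|a x] /=.
- by rewrite D addrACA.
- by rewrite l lactDr.
- by rewrite r ractDl.
Qed.

Let lactE (a b : A) : a *> b = a * b. Proof. by []. Qed.
Let ractE (a b : A) : a <* b = a * b. Proof. by []. Qed.

Let src1_exchange y : exchange ssum tsum (@id A) y -> ssum y.1 + y.2 = 0.
Proof.
have sm := bimod_ext_morphism (@gsrc K X); case: (sm) => D l r.
case=> a b /=; rewrite D (bimod_morphN sm) !D !l !r !lactE !ractE.
by rewrite addrACA -opprD !addrK subrr.
Qed.

Let tgt1_exchange y : exchange ssum tsum (@id A) y -> tsum y.1 + y.2 = 0.
Proof.
have tm := bimod_ext_morphism (@gtgt K X); case: (tm) => D l r.
case=> a b /=; rewrite D (bimod_morphN tm) !D !l !r !lactE !ractE.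
by rewrite addrACA -opprD [X in X - _]addrC addKr [X in _ - X]addrC addKr subrr.
Qed.

Lemma src1E (x : E) (a : A) : src1 (bproj _ (x, a)) = ssum x + a.
Proof. exact: (blift_bproj (x, a) src1_morphism src1_exchange). Qed.

Lemma tgt1E (x : E) (a : A) : tgt1 (bproj _ (x, a)) = tsum x + a.
Proof. exact: (blift_bproj (x, a) tgt1_morphism tgt1_exchange). Qed.

Lemma src1_bimod_morphism : bimod_morphism src1.
Proof. exact: blift_morphism src1_morphism src1_exchange. Qed.

Lemma tgt1_bimod_morphism : bimod_morphism tgt1.
Proof. exact: blift_morphism tgt1_morphism tgt1_exchange. Qed.

Let subrDD (V : zmodType) (x y z : V) : (x + z) - (y + z) = x - y.
Proof. by rewrite opprD addrACA subrr addr0. Qed.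

(* The two formulas for the product of 1-cells agree. *)
Lemma interchange1 (f g : cell1) :
  f <* src1 g + tgt1 f *> g - id1 (tgt1 f * src1 g)
  = src1 f *> g + f <* tgt1 g - id1 (src1 f * tgt1 g).
Proof.
pose P := exchange ssum tsum (@id A).
have bprojB (x y : E * A) : bproj P (x - y) = bproj P x - bproj P y.
  by apply: (addIr (bproj P y)); rewrite -bprojD !subrK.
rewrite -[f]breprK -[g]breprK.
case: (brepr f) => a c; case: (brepr g) => b d.
rewrite !src1E !tgt1E /id1 -!bproj_lact -!bproj_ract -!bprojD -!bprojB.
apply/bproj_eqP/Subbimod_gen.
have PE z : z = ((a <* ssum b + tsum a *> b, - (tsum a * ssum b))
            - (ssum a *> b + a <* tsum b, - (ssum a * tsum b))) -> P z.
  by move=> ->; split.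
apply: PE; congr pair => /=.
  rewrite !ractDr !lactDl !subr0 [X in X - _]addrACA [X in _ - X]addrACA.
  by rewrite [c *> b + _]addrC subrDD.
have aux (x y : A) :
    c * (y + d) + (x + c) * d - (x + c) * (y + d) = - (x * y) + c * d.
  rewrite [(x + c) * (y + d)]mulrDl [c * _ + _]addrC subrDD.
  by rewrite mulrDl mulrDr [x * d + _]addrC subrDD addrC.
rewrite !lactE !ractE.
have -> : (ssum a + c) * d + c * (tsum b + d) - (ssum a + c) * (tsum b + d)
        = - (ssum a * tsum b) + c * d by rewrite [X in X - _]addrC aux.
by rewrite aux subrDD.
Qed.

End OneCells.

Section Rewriting.
Context (K : fieldType) (X : polygraph1 K).
Local Notation A := (free_alg K (gen0 X)).
Local Notation W := {fmonom gen0 X}.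

Definition left_monomial : Prop :=
  forall x : gen1 X, exists2 w : W, gsrc x = mon K w & w \notin supp (gtgt x).

Definition is_mono1 (f : cell1 X) : Prop := exists u x v, f = mono1 u x v.

Definition rewriting_step (r : cell1 X) : Prop :=
  exists (c : K) (f : cell1 X) (a : A) (w : W),
    [/\ c != 0, is_mono1 f, src1 f = mon K w, w \notin supp a
      & r = c *: f + id1 a].

Inductive positive : cell1 X -> Prop :=
| Positive_id (a : A) : positive (id1 a)
| Positive_step (f g : cell1 X) of
    rewriting_step f & positive g & tgt1 f = src1 g : positive (comp1 f g).

(* Stability by product means stability by contexts w |-> u w v.              *)
Inductive succX : W -> W -> Prop :=
| SuccX_gen (x : gen1 X) (w v : W) of
    gsrc x = mon K w & v \in supp (gtgt x) : succX w v
| SuccX_trans (u v w : W) of succX u v & succX v w : succX u w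
| SuccX_mul (u w w' v : W) of
    succX w w' : succX (mmul (mmul u w) v) (mmul (mmul u w') v).

Definition terminating : Prop := well_founded (fun v u : W => succX u v).

Definition branching (f g : cell1 X) : Prop :=
  [/\ positive f, positive g & src1 f = src1 g].

Definition confluent : Prop := forall f g, branching f g ->
  exists h k, [/\ positive h /\ positive k,
    src1 h = tgt1 f, src1 k = tgt1 g & tgt1 h = tgt1 k].

Definition convergent : Prop := terminating /\ confluent.

Definition peiffer (f g : cell1 X) : Prop :=
  exists (u v : W) (f' g' : cell1 X),
    [/\ is_mono1 f' /\ is_mono1 g', src1 f' = mon K u, src1 g' = mon K v,
        f = f' <* mon K v & g = mon K u *> g'].

(* The inner branching f', g' consists of arbitrary positive 1-cells.         *)
Definition decomposable (f g : cell1 X) : Prop :=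
  exists (u v : W) (f' g' : cell1 X),
    [/\ branching f' g', ~ (u = mone /\ v = mone),
        f = mon K u *> f' <* mon K v & g = mon K u *> g' <* mon K v].

Definition critical_branching (f g : cell1 X) : Prop :=
  [/\ is_mono1 f, is_mono1 g & src1 f = src1 g] /\
  [/\ f <> g, ~ peiffer f g, ~ peiffer g f & ~ decomposable f g].

End Rewriting.

Record cellular_extension (K : fieldType) (X : polygraph1 K) :=
  CellularExtension {
  gen2 : choiceType;
  gsrc2 : gen2 -> cell1 X;
  gtgt2 : gen2 -> cell1 X;
  gglob_src : forall y, src1 (gsrc2 y) = src1 (gtgt2 y);
  gglob_tgt : forall y, tgt1 (gsrc2 y) = tgt1 (gtgt2 y)
}.

Section TwoCells.
Context (K : fieldType) (X : polygraph1 K) (Y : cellular_extension X).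
Local Notation A := (free_alg K (gen0 X)).
Local Notation E := (free_bimod K (gen0 X) (gen2 Y)).
Local Notation ssum := (bimod_ext (@gsrc2 K X Y)).
Local Notation tsum := (bimod_ext (@gtgt2 K X Y)).

(* The 2-cells of the free 2-algebra A(X)[Y].  By globularity, the            *)
(* 0-dimensional source and target may be computed on either face.            *)
Definition cell2 : Type :=
  free_cells (@src1 K X \o ssum) (@tgt1 K X \o tsum) (@id1 K X).
HB.instance Definition _ := Bimodule.on cell2.

Definition src2 : cell2 -> cell1 X := blift (fun x => ssum x.1 + x.2).
Definition tgt2 : cell2 -> cell1 X := blift (fun x => tsum x.1 + x.2).

Lemma glob_src (x : E) : src1 (ssum x) = src1 (tsum x).
Proof.
apply: (bimod_morphism_ext (phi := @src1 K X \o ssum)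
                           (psi := @src1 K X \o tsum)) => [||y] /=.
- exact: bimod_morphism_comp (src1_bimod_morphism X) (bimod_ext_morphism _).
- exact: bimod_morphism_comp (src1_bimod_morphism X) (bimod_ext_morphism _).
- by rewrite !bimod_extE mon1 !lact1 !ract1 gglob_src.
Qed.

Lemma glob_tgt (x : E) : tgt1 (ssum x) = tgt1 (tsum x).
Proof.
apply: (bimod_morphism_ext (phi := @tgt1 K X \o ssum)
                           (psi := @tgt1 K X \o tsum)) => [||y] /=.
- exact: bimod_morphism_comp (tgt1_bimod_morphism X) (bimod_ext_morphism _).
- exact: bimod_morphism_comp (tgt1_bimod_morphism X) (bimod_ext_morphism _).
- by rewrite !bimod_extE mon1 !lact1 !ract1 gglob_tgt.
Qed.

Let face_morphism (h : gen2 Y -> cell1 X) :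
  bimod_morphism (fun x : E * cell1 X => bimod_ext h x.1 + x.2).
Proof.
have [D l r] := bimod_ext_morphism h.
split=> [x y|a x|a x] /=.
- by rewrite D addrACA.
- by rewrite l lactDr.
- by rewrite r ractDl.
Qed.

Let src2_exchange y :
  exchange (@src1 K X \o ssum) (@tgt1 K X \o tsum) (@id1 K X) y ->
  ssum y.1 + y.2 = 0.
Proof.
have sm := bimod_ext_morphism (@gsrc2 K X Y); case: (sm) => D l r.
have phiB p p' (q q' : cell1 X) : ssum p - ssum p' + (q - q') = ssum p + q - (ssum p' + q').
  by rewrite addrACA -opprD.
case=> a b; apply: etrans (_ : ssum (a <* src1 (ssum b) + tgt1 (tsum a) *> b)
    - ssum (src1 (ssum a) *> b + a <* tgt1 (tsum b))
    + (- id1 (tgt1 (tsum a) * src1 (ssum b))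
       - - id1 (src1 (ssum a) * tgt1 (tsum b))) = 0).
  by congr (_ + _); rewrite -(bimod_morphN sm) -D.
rewrite phiB !D (r (src1 (ssum b))) (r (tgt1 (tsum b))).
rewrite (l (src1 (ssum a))) (l (tgt1 (tsum a))).
by rewrite -!glob_tgt interchange1 subrr.
Qed.

Let tgt2_exchange y :
  exchange (@src1 K X \o ssum) (@tgt1 K X \o tsum) (@id1 K X) y ->
  tsum y.1 + y.2 = 0.
Proof.
have tm := bimod_ext_morphism (@gtgt2 K X Y); case: (tm) => D l r.
have phiB p p' (q q' : cell1 X) : tsum p - tsum p' + (q - q') = tsum p + q - (tsum p' + q').
  by rewrite addrACA -opprD.
case=> a b; apply: etrans (_ : tsum (a <* src1 (ssum b) + tgt1 (tsum a) *> b)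
    - tsum (src1 (ssum a) *> b + a <* tgt1 (tsum b))
    + (- id1 (tgt1 (tsum a) * src1 (ssum b))
       - - id1 (src1 (ssum a) * tgt1 (tsum b))) = 0).
  by congr (_ + _); rewrite -(bimod_morphN tm) -D.
rewrite phiB !D (r (src1 (ssum b))) (r (tgt1 (tsum b))).
rewrite (l (src1 (ssum a))) (l (tgt1 (tsum a))).
by rewrite !glob_src interchange1 subrr.
Qed.

Lemma src2E (x : E) (f : cell1 X) : src2 (bproj _ (x, f)) = ssum x + f.
Proof. exact: (blift_bproj (x, f) (face_morphism _) src2_exchange). Qed.

Lemma tgt2E (x : E) (f : cell1 X) : tgt2 (bproj _ (x, f)) = tsum x + f.
Proof. exact: (blift_bproj (x, f) (face_morphism _) tgt2_exchange). Qed.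

Definition acyclic : Prop := forall f g : cell1 X,
  src1 f = src1 g -> tgt1 f = tgt1 g ->
  exists F : cell2, src2 F = f /\ tgt2 F = g.

Definition filled_by (f g : cell1 X) (y : gen2 Y) : Prop :=
  exists h k, [/\ [/\ positive h, positive k,
      src1 h = tgt1 f, src1 k = tgt1 g & tgt1 h = tgt1 k],
    gsrc2 y = comp1 f h & gtgt2 y = comp1 g k].

(* Branchings are unordered: a 2-cell for (g, f) is one for (f, g). *)
Definition contains_critical_cells : Prop :=
  forall f g, critical_branching f g ->
  exists y, filled_by f g y \/ filled_by g f y.

End TwoCells.

(* Main.v *)
Require Import Defs.
From mathcomp Require Import all_boot all_algebra.
From mathcomp Require Import finmap boolp monalg.

(** The composite of two 1-cells is f - 1_b + g, so everything takes place in
    bimodules and the theorem becomes a statement of linear algebra.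

    Two 1-cells are joined by a 2-cell exactly when their difference lies in the
    sub-bimodule generated by the differences s(y) - t(y) of the faces of the
    2-cells y of Y ([boundary], [boundary_cell2]).  Hence Y is acyclic as soon as
    every 1-cell z with s(z) = t(z) = 0 is a boundary ([acyclic_boundary]).

    Since X is left-monomial and terminates, a reduction strategy gives every
    monomial w a 1-cell phi(w): zero if w is irreducible, and otherwise
    e - 1_w + phi(t(e)) for a chosen 1-monomial e with source w, phi being
    extended linearly ([reduction_exists]).  Thus 1_w + phi(w) is the chosen
    reduction of w to a normal form.  The defect of a 1-cell f,
      D(f) = f - 1_(s(f)) + phi(t(f)) - phi(s(f)),
    compares f followed by the strategy with the strategy alone.  It is
    linear in f, vanishes on identities, is therefore additive under composition,
    and D(z) = z when s(z) = t(z) = 0.  So it is enough that D(f) is a boundary,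
    i.e. that f is coherent, for every f; as 1-cells are spanned by identities
    and 1-monomials ([cell1_ind]), only 1-monomials matter.

    Those are treated by wellfounded induction on the source w
    ([mono1_coherent]).  The chosen e has D(e) = 0, so one compares two
    1-monomials with source w ([local_equicoherent]).  For a Peiffer pair the
    interchange relation expresses D(f) - D(g) through cells with smaller
    sources; for a critical pair Y provides a boundary
    (f followed by h) - (g followed by k), where h and k only rewrite
    monomials smaller than w.  A decomposable pair u(f',g')v reduces to a shorter
    overlap; because multiplication by u and v does not commute with phi, the
    comparison is made for all contexts u, v at once, with the product u m v
    fixed to be w and induction on the length of m. *)

Set Implicit Arguments.
Unset Strict Implicit.
Unset Printing Implicit Defensive.

Import GRing.Theory.

Local Open Scope ring_scope.

(** * Monomial contexts and supports *)

Section Contexts.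
Context (K : fieldType) (X0 : choiceType).
Local Notation A := (free_alg K X0).
Local Notation W := {fmonom X0}.
Implicit Types (a b : A) (u v w m : W).

Definition whisker (M : bimodType A) u v (x : M) : M :=
  mon K u *> x <* mon K v.

Section Linearity.
Context (M : bimodType A).
Implicit Types x y : M.

Lemma whiskerD u v x y :
  whisker u v (x + y) = whisker u v x + whisker u v y.
Proof. by rewrite /whisker lactDr ractDl. Qed.

Lemma whiskerZ u v (c : K) x : whisker u v (c *: x) = c *: whisker u v x.
Proof. by rewrite /whisker lactZr ractZl. Qed.

Lemma whiskerB u v x y :
  whisker u v (x - y) = whisker u v x - whisker u v y.
Proof. by rewrite /whisker lactBr ractBl. Qed.

Lemma whisker0 u v : whisker u v (0 : M) = 0.
Proof. by rewrite /whisker lactr0 ract0r. Qed.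

Lemma whiskerA u u' v v' x :
  whisker u v (whisker u' v' x) = whisker (mmul u u') (mmul v' v) x.
Proof. by rewrite /whisker !monM lactA ractA -lractA. Qed.

Lemma whisker_lact_mon u v w x :
  whisker u v (mon K w *> x) = whisker (mmul u w) v x.
Proof. by rewrite /whisker monM lactA. Qed.

Lemma whisker_ract_mon u v w x :
  whisker u v (x <* mon K w) = whisker u (mmul w v) x.
Proof. by rewrite /whisker monM ractA -lractA. Qed.

Lemma whisker_one x : whisker mone mone x = x.
Proof. by rewrite /whisker mon1 lact1 ract1. Qed.

Lemma whisker_morph (M' : bimodType A) (phi : M -> M') u v x :
  bimod_morphism phi -> phi (whisker u v x) = whisker u v (phi x).
Proof. by case=> _ phil phir; rewrite /whisker phir phil. Qed.

End Linearity.

Lemma mmul_val u v : mmul u v = u ++ v :> seq X0.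
Proof. by rewrite [mmul u v]fmmulE. Qed.

(** Cancellation on both sides in the free monoid: it lets contexts be
    stripped from coefficients and supports below. *)
Lemma mmul_ctx_inj u v : injective (fun m => mmul (mmul u m) v).
Proof.
move=> m m' /(congr1 (fun w : W => drop (size u) w)).
rewrite /= !mmul_val -!catA !drop_size_cat // => /(congr1 rev).
rewrite !rev_cat => /(congr1 (drop (size (rev v)))).
by rewrite !drop_size_cat // => /(can_inj revK) /val_inj.
Qed.

Lemma whisker_mon u v m :
  whisker u v (mon K m : A) = mon K (mmul (mmul u m) v).
Proof. by rewrite !monM. Qed.

Lemma mcoeff_mon m m' : mcoeff m' (mon K m) = (m == m')%:R.
Proof. by rewrite /mon fbasisE mcoeffU. Qed.

Lemma mcoeff_whisker u v a m :
  mcoeff (mmul (mmul u m) v) (whisker u v a) = mcoeff m a.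
Proof.
elim/free_alg_ind: a => [w|a b IHa IHb|c a IH|].
- by rewrite whisker_mon !mcoeff_mon (inj_eq (@mmul_ctx_inj u v)).
- by rewrite whiskerD !mcoeffD IHa IHb.
- by rewrite whiskerZ !mcoeff_free_scale IH.
- by rewrite whisker0 !mcoeff0.
Qed.

Lemma mem_supp a m : (m \in supp a) = (mcoeff m a != 0).
Proof. by rewrite mcoeff_neq0. Qed.

Lemma supp_mon m m' : (m' \in supp (mon K m)) = (m' == m).
Proof.
rewrite mem_supp mcoeff_mon [m == _]eq_sym.
by case: (m' == m); rewrite ?oner_neq0 ?eqxx.
Qed.

Lemma supp_whisker u v a w : w \in supp (whisker u v a) ->
  exists2 m, w = mmul (mmul u m) v & m \in supp a.
Proof.
case: (pselect (exists m, w = mmul (mmul u m) v)) => [[m ->]|notctx].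
  by rewrite mem_supp mcoeff_whisker -mem_supp; exists m.
rewrite mem_supp => /eqP[].
elim/free_alg_ind: a => [m|a b IHa IHb|c a IH|].
- rewrite whisker_mon mcoeff_mon; case: eqP => // eqw.
  by case: notctx; exists m.
- by rewrite whiskerD mcoeffD IHa IHb addr0.
- by rewrite whiskerZ mcoeff_free_scale IH mulr0.
- by rewrite whisker0 mcoeff0.
Qed.

Lemma whisker_eq_mon u v a w : whisker u v a = mon K w ->
  exists2 m, w = mmul (mmul u m) v & a = mon K m.
Proof.
move=> eqw; have : w \in supp (whisker u v a) by rewrite eqw supp_mon.
case/supp_whisker => m wE _; exists m => //.
apply/malgP=> m'; rewrite -(mcoeff_whisker u v) eqw wE !mcoeff_mon.
by rewrite (inj_eq (@mmul_ctx_inj u v)).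
Qed.

Lemma mon_inj : injective (@mon K X0).
Proof.
by move=> m m' eqm; apply/eqP; rewrite -supp_mon -eqm supp_mon.
Qed.

Lemma supp_scaleD (c : K) a b w :
  w \in supp (c *: a + b) -> w \in supp a \/ w \in supp b.
Proof.
rewrite !mem_supp mcoeffD mcoeff_free_scale.
case: (eqVneq (mcoeff w a) 0) => [->|]; last by left.
by rewrite mulr0 add0r; right.
Qed.

(** Expanding a over its support: linear properties of a follow from
    the monomials that actually occur in it. *)
Lemma supp_ind a (P : A -> Prop) :
  (forall a b, P a -> P b -> P (a + b)) -> (forall c a, P a -> P (c *: a)) ->
  (forall m, m \in supp a -> P (mon K m)) -> P 0 -> P a.
Proof.
move=> PD PZ Pm P0; rewrite [a]monalgE big_seq.
elim/big_rec: _ => // m b am Pb; apply: (PD) => //.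
by rewrite -scale_fbasis; apply/PZ/Pm.
Qed.

Lemma linext_supp (V : lmodType K) (h1 h2 : W -> V) a :
  {in supp a, h1 =1 h2} -> linext h1 a = linext h2 a.
Proof.
by move=> eqh; rewrite unlock; apply: eq_big_seq => m /eqh ->.
Qed.

End Contexts.

(** * Sources, targets and rewriting steps *)

Section Cells.
Context (K : fieldType) (X : polygraph1 K).
Local Notation A := (free_alg K (gen0 X)).
Local Notation W := {fmonom gen0 X}.
Implicit Types (f g h : cell1 X) (a b : A) (u v w : W).

Lemma id1_bimod_morphism : bimod_morphism (@id1 K X).
Proof.
split=> [a b|a b|a b]; rewrite /id1.
- by rewrite -bprojD; congr bproj; congr pair; rewrite addr0.
- by rewrite -bproj_lact; congr bproj; congr pair; rewrite lactr0.
- by rewrite -bproj_ract; congr bproj; congr pair; rewrite ract0r.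
Qed.

Lemma src1_id1 a : src1 (id1 a) = a.
Proof. by rewrite src1E (bimod_morph0 (bimod_ext_morphism _)) add0r. Qed.

Lemma tgt1_id1 a : tgt1 (id1 a) = a.
Proof. by rewrite tgt1E (bimod_morph0 (bimod_ext_morphism _)) add0r. Qed.

Lemma src1_mono1 u x v : src1 (mono1 u x v) = whisker u v (gsrc x).
Proof. by rewrite src1E addr0 bimod_extE. Qed.

Lemma tgt1_mono1 u x v : tgt1 (mono1 u x v) = whisker u v (gtgt x).
Proof. by rewrite tgt1E addr0 bimod_extE. Qed.

Lemma src1D f g : src1 (f + g) = src1 f + src1 g.
Proof. by have [] := src1_bimod_morphism X. Qed.

Lemma tgt1D f g : tgt1 (f + g) = tgt1 f + tgt1 g.
Proof. by have [] := tgt1_bimod_morphism X. Qed.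

Lemma src1Z c f : src1 (c *: f) = c *: src1 f.
Proof. exact: bimod_morphZ (src1_bimod_morphism X) c f. Qed.

Lemma tgt1Z c f : tgt1 (c *: f) = c *: tgt1 f.
Proof. exact: bimod_morphZ (tgt1_bimod_morphism X) c f. Qed.

Lemma src1_whisker u v f : src1 (whisker u v f) = whisker u v (src1 f).
Proof. exact: whisker_morph (src1_bimod_morphism X). Qed.

Lemma tgt1_whisker u v f : tgt1 (whisker u v f) = whisker u v (tgt1 f).
Proof. exact: whisker_morph (tgt1_bimod_morphism X). Qed.

Lemma id1_whisker u v a : id1 (whisker u v a) = whisker u v (id1 a).
Proof. exact: whisker_morph id1_bimod_morphism. Qed.

Lemma src1B f g : src1 (f - g) = src1 f - src1 g.
Proof. by rewrite src1D (bimod_morphN (src1_bimod_morphism X)). Qed.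

Lemma tgt1B f g : tgt1 (f - g) = tgt1 f - tgt1 g.
Proof. by rewrite tgt1D (bimod_morphN (tgt1_bimod_morphism X)). Qed.

Lemma src1_comp f g : tgt1 f = src1 g -> src1 (comp1 f g) = src1 f.
Proof. by move=> fg; rewrite src1D src1B src1_id1 fg subrK. Qed.

Lemma tgt1_comp f g : tgt1 (comp1 f g) = tgt1 g.
Proof. by rewrite tgt1D tgt1B tgt1_id1 subrr add0r. Qed.

Lemma mono1_whisker u v f : is_mono1 f -> is_mono1 (whisker u v f).
Proof.
case=> u' [x [v' ->]]; exists (mmul u u'), x, (mmul v' v).
rewrite /mono1 /whisker -bproj_lact -bproj_ract; congr bproj; congr pair.
  by rewrite /= -[LHS]/(free_ract (free_lact _ _) _) free_lactE free_ractE.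
by rewrite /= lactr0 ract0r.
Qed.

Lemma cell1_ind (P : cell1 X -> Prop) :
  (forall f, is_mono1 f -> P f) -> (forall a, P (id1 a)) ->
  (forall f g, P f -> P g -> P (f + g)) -> (forall c f, P f -> P (c *: f)) ->
  forall f, P f.
Proof.
move=> Pm Pi PD PZ f; rewrite -[f]breprK; case: (brepr f) => x a.
have -> : (x, a) = (x, 0) + (0, a) :> _ * _.
  by congr pair; rewrite ?addr0 ?add0r.
rewrite bprojD; apply: (PD); last exact: (Pi).
elim/free_bimod_ind: x => [u y v|m n IHm IHn|c m IH|]; last exact: (Pi 0).
- by apply: Pm; exists u, y, v.
- have -> : (m + n, 0) = (m, 0) + (n, 0) :> _ * A.
    by congr pair; rewrite addr0.
  by rewrite bprojD; apply: PD.
- have -> : (c *: m, 0) = c *: ((m, 0) : _ * A).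
    by congr pair; rewrite scaler0.
  by rewrite bprojZ; apply: PZ.
Qed.

(** Since w does not occur in a, no cancellation takes place in the source
    c w + a: the step rewrites a monomial of its source and keeps
    only monomials that were already there. *)
Lemma step_src r : rewriting_step r -> exists (c : K) f a w,
  [/\ is_mono1 f, src1 f = mon K w, w \in supp (src1 r),
      {subset supp a <= supp (src1 r)} & r = c *: f + id1 a].
Proof.
case=> c [f [a [w [c0 fm sf wa rE]]]]; exists c, f, a, w.
have aw : mcoeff w a = 0 by apply/eqP; rewrite -[_ == _]negbK -mem_supp.
split=> // [|w']; rewrite rE src1D src1Z src1_id1 sf.
  by rewrite mem_supp mcoeffD mcoeff_free_scale mcoeff_mon eqxx mulr1 aw addr0.
have [-> /(negP wa)//|ww'] := eqVneq w' w.
rewrite !mem_supp mcoeffD mcoeff_free_scale mcoeff_mon [w == _]eq_sym.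
by rewrite (negPf ww') mulr0 add0r.
Qed.

(** A step c f + 1_a whose source c w + a is a single monomial has
    c = 1 and a = 0, again because w does not occur in a. *)
Lemma step_mono1 r w : rewriting_step r -> src1 r = mon K w -> is_mono1 r.
Proof.
case=> c [f [a [w' [c0 fm sf wa ->]]]]; rewrite src1D src1Z src1_id1 sf => eqw.
have aw : mcoeff w' a = 0 by apply/eqP; rewrite -[_ == _]negbK -mem_supp.
have := congr1 (mcoeff w') eqw.
rewrite mcoeffD mcoeff_free_scale !mcoeff_mon eqxx mulr1 aw addr0.
case: eqP => [ww' c1|_ /eqP]; last by rewrite (negPf c0).
move: eqw; rewrite c1 ww' scale1r => /(canRL (addKr _)).
by rewrite addNr scale1r => ->; rewrite (bimod_morph0 id1_bimod_morphism) addr0.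
Qed.

(** The inner branching of a decomposition consists of arbitrary positive
    cells; this recovers the 1-monomial with which each of them begins. *)
Lemma positive_src_mon p w : positive p -> src1 p = mon K w ->
  p = id1 (mon K w) \/
  exists f h, [/\ is_mono1 f, src1 f = mon K w, positive h,
                  tgt1 f = src1 h & p = comp1 f h].
Proof.
case=> [a|f h fs hp fh]; first by rewrite src1_id1 => ->; left.
rewrite (src1_comp fh) => sf; right; exists f, h.
by split=> //; apply: step_mono1 fs sf.
Qed.

Section LeftMonomial.
Context (leftX : left_monomial X).

Lemma mono1_src f : is_mono1 f -> exists w, src1 f = mon K w.
Proof.
case=> u [x [v ->]]; have [w sx _] := leftX x.
by exists (mmul (mmul u w) v); rewrite src1_mono1 sx whisker_mon.
Qed.

Lemma mono1_succ f w w' : is_mono1 f -> src1 f = mon K w ->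
  w' \in supp (tgt1 f) -> succX w w'.
Proof.
case=> u [x [v ->]]; have [s sx _] := leftX x.
rewrite src1_mono1 tgt1_mono1 sx whisker_mon => /mon_inj <-.
by case/supp_whisker=> m -> tm; apply/SuccX_mul/(SuccX_gen sx).
Qed.

(** Excludes identities among the members of a decomposition of a
    1-monomial. *)
Lemma mono1_tgt_neq_src f : is_mono1 f -> tgt1 f <> src1 f.
Proof.
case=> u [x [v ->]]; have [w sx wt] := leftX x.
rewrite src1_mono1 tgt1_mono1 sx => eqt.
have := mcoeff_whisker u v (mon K w) w.
rewrite -eqt mcoeff_whisker mcoeff_mon eqxx => /eqP.
move: wt; rewrite mem_supp negbK => /eqP -> /eqP/esym/eqP.
by rewrite (negPf (oner_neq0 K)).
Qed.

End LeftMonomial.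
End Cells.

(** * Boundaries of 2-cells *)

Section Boundaries.
Context (K : fieldType) (X : polygraph1 K) (Y : cellular_extension X).

Definition boundary : cell1 X -> Prop :=
  subbimod_gen (fun z => exists y : gen2 Y, z = gsrc2 y - gtgt2 y).

Lemma boundaryN z : boundary z -> boundary (- z).
Proof.
move=> Bz; have -> : - z = (-1) *> z.
  by rewrite -[X in _ = X *> _]scaleN1r lactZl lact1 scaleN1r.
exact: Subbimod_l.
Qed.

Lemma boundaryB z z' : boundary z -> boundary z' -> boundary (z - z').
Proof. by move=> Bz Bz'; apply: Subbimod_D => //; apply: boundaryN. Qed.

Lemma boundaryZ (c : K) z : boundary z -> boundary (c *: z).
Proof. by move=> Bz; rewrite -[z]lact1 -lactZl; apply: Subbimod_l. Qed.

Lemma boundary_whisker u v z : boundary z -> boundary (whisker u v z).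
Proof. by move=> Bz; apply/Subbimod_r/Subbimod_l. Qed.

(** A boundary is s(x) - t(x) for some x in the free bimodule on Y; adding the
    1-cell g - t(x) to x gives a 2-cell with faces f and g. *)
Lemma boundary_cell2 f g : boundary (f - g) ->
  exists F : cell2 Y, src2 F = f /\ tgt2 F = g.
Proof.
pose ssum := bimod_ext (@gsrc2 K X Y); pose tsum := bimod_ext (@gtgt2 K X Y).
have [sD sl sr] := bimod_ext_morphism (@gsrc2 K X Y).
have [tD tl tr] := bimod_ext_morphism (@gtgt2 K X Y).
suff bound z : boundary z -> exists x, z = ssum x - tsum x.
  case/bound=> x eqx; exists (bproj _ (x, g - tsum x)).
  by rewrite src2E tgt2E addrCA -eqx addrC subrK addrC subrK.
elim=> {z} [z [y ->]||z z' _ [x ->] _ [x' ->]|a z _ [x ->]|a z _ [x ->]].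
- exists (fgen K mone y mone).
  by rewrite /ssum /tsum !bimod_extE mon1 !lact1 !ract1.
- exists 0; rewrite /ssum /tsum.
  by rewrite !(bimod_morph0 (bimod_ext_morphism _)) subrr.
- by exists (x + x'); rewrite /ssum /tsum sD tD opprD addrACA.
- by exists (a *> x); rewrite /ssum /tsum sl tl lactBr.
- by exists (x <* a); rewrite /ssum /tsum sr tr ractBl.
Qed.

Lemma acyclic_boundary :
  (forall z : cell1 X, src1 z = 0 -> tgt1 z = 0 -> boundary z) -> acyclic Y.
Proof.
move=> B f g sfg tfg; apply/boundary_cell2/B.
  by rewrite src1B sfg subrr.
by rewrite tgt1B tfg subrr.
Qed.

End Boundaries.

(** * A reduction strategy and the defect of a 1-cell *)

Section Reduction.
Context (K : fieldType) (X : polygraph1 K).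
Local Notation A := (free_alg K (gen0 X)).
Local Notation W := {fmonom gen0 X}.
Implicit Types (f g h : cell1 X) (a b : A) (u v w : W).

(** Recursion along the rewriting order: the monomials of t(e) are
    smaller than w, so phi is already known on them.  The lemma hides the
    value 0 given to irreducible monomials, which are not the source of any
    1-monomial f. *)
Lemma reduction_exists : left_monomial X -> terminating X ->
  exists phi : W -> cell1 X, forall w f, is_mono1 f -> src1 f = mon K w ->
  exists e, [/\ is_mono1 e, src1 e = mon K w &
    phi w = e - id1 (src1 e) + linext phi (tgt1 e)].
Proof.
move=> leftX wf; pose redex w f := is_mono1 f /\ src1 f = mon K w.
(* Guards the recursive calls: extended linearly, phi would otherwise be
   called on monomials that are not known to be smaller. *)
pose restrict w (rec : forall w', succX w w' -> cell1 X) w' : cell1 X :=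
  if pselect (succX w w') is left ww' then rec w' ww' else 0.
pose body w rec : cell1 X := if pselect (exists f, redex w f) is left wr then
  let e := projT1 (cid wr) in
  e - id1 (src1 e) + linext (restrict w rec) (tgt1 e) else 0.
exists (Fix wf (fun _ => cell1 X) body) => w f fm sf.
rewrite Fix_eq => [|w' rec rec' eqrec]; last first.
  by congr body; apply: functional_extensionality_dep => w'';
     apply: functional_extensionality_dep.
rewrite {1}/body; case: pselect => [wr|[]]; last by exists f.
case: (cid wr) => e [em se] /=; exists e; split=> //; congr (_ + _).
apply: linext_supp => w' /(mono1_succ leftX em se) ww'.
by rewrite /restrict; case: pselect.
Qed.

Context (phi : W -> cell1 X).

(** The difference, in the bimodule of 1-cells, between f followed by the
    chosen reduction of t(f) and the chosen reduction of s(f). *)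
Definition defect f : cell1 X :=
  f - id1 (src1 f) + linext phi (tgt1 f) - linext phi (src1 f).

Lemma defectD f g : defect (f + g) = defect f + defect g.
Proof.
rewrite /defect src1D tgt1D !linextD; have [-> _ _] := id1_bimod_morphism X.
rewrite !opprD [X in X + _ + _ = _]addrACA [X in X + _ = _]addrACA.
exact: addrACA.
Qed.

Lemma defectZ c f : defect (c *: f) = c *: defect f.
Proof.
rewrite /defect src1Z tgt1Z !linextZ (bimod_morphZ (id1_bimod_morphism X)).
by rewrite !(scalerDr, scalerN).
Qed.

Lemma defectB f g : defect (f - g) = defect f - defect g.
Proof. by rewrite defectD -scaleN1r defectZ scaleN1r. Qed.

Lemma defect_id1 a : defect (id1 a) = 0.
Proof. by rewrite /defect src1_id1 tgt1_id1 subrr add0r subrr. Qed.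

(** The reason to study the defect: on the cells that have to be filled it is
    the identity. *)
Lemma defect_loop f : src1 f = 0 -> tgt1 f = 0 -> defect f = f.
Proof.
move=> sf tf; rewrite /defect sf tf (bimod_morph0 (id1_bimod_morphism X)).
by rewrite subr0 addrK.
Qed.

End Reduction.

(** * Coherence of 1-monomials *)

Lemma addr_eq_subr (V : zmodType) (a b c d : V) :
  a + b = c + d -> a - c = d - b.
Proof. by move=> eqV; rewrite -[a](addrK b) eqV addrAC [c + d]addrC addrK. Qed.

Section Squier.
Context (K : fieldType) (X : polygraph1 K) (Y : cellular_extension X).
Local Notation A := (free_alg K (gen0 X)).
Local Notation W := {fmonom gen0 X}.
Implicit Types (f g h : cell1 X) (a b : A) (u v w m : W).

Context (leftX : left_monomial X).
Context (phi : W -> cell1 X).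
Local Notation D := (defect phi).
Local Notation coherent f := (boundary Y (defect phi f)).

Lemma coherentD f g : coherent f -> coherent g -> coherent (f + g).
Proof. by rewrite defectD; apply: Subbimod_D. Qed.

Lemma coherentZ (c : K) f : coherent f -> coherent (c *: f).
Proof. by rewrite defectZ; apply: boundaryZ. Qed.

Lemma coherent_id1 a : coherent (id1 a).
Proof. by rewrite defect_id1; apply: Subbimod_0. Qed.

Lemma defect_whisker_subid u v f a :
  D (whisker u v (f - id1 a)) = D (whisker u v f).
Proof. by rewrite whiskerB -id1_whisker defectB defect_id1 subr0. Qed.

Lemma defect_whisker_comp u v f g :
  D (whisker u v (comp1 f g)) = D (whisker u v f) + D (whisker u v g).
Proof. by rewrite whiskerD defectD defect_whisker_subid. Qed.

Section Below.
Context (w : W) (coh_below : forall w', succX w w' -> forall f,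
  is_mono1 f -> src1 f = mon K w' -> coherent f).

(** Along a positive cell every rewritten monomial is, in the context u, v,
    smaller than w, because steps only produce monomials that are old or
    smaller; so each step is coherent by induction. *)
Lemma coherent_positive u v p : positive p ->
  (forall m, m \in supp (src1 p) -> succX w (mmul (mmul u m) v)) ->
  coherent (whisker u v p).
Proof.
elim=> {p} [a _|r p rs _ IH rp].
  by rewrite -id1_whisker; apply: coherent_id1.
rewrite (src1_comp rp) => below.
have [c [f [a [m [fm sf mr ar rE]]]]] := step_src rs.
rewrite defect_whisker_comp; apply: Subbimod_D; last first.
  apply: IH => m'; rewrite -rp rE tgt1D tgt1Z tgt1_id1.
  case/supp_scaleD=> [m't|/ar]; last exact: below.
  apply: SuccX_trans (below _ mr) _; apply: SuccX_mul.
  exact: mono1_succ m't.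
rewrite rE whiskerD whiskerZ -id1_whisker; apply: coherentD (coherent_id1 _).
apply/coherentZ/(coh_below (below _ mr)); first exact: mono1_whisker.
by rewrite src1_whisker sf whisker_mon.
Qed.

(** Stated in a context because whiskering does not commute with the
    defect: phi(u m v) need not be u phi(m) v. *)
Definition equicoherent u v f g :=
  boundary Y (D (whisker u v f) - D (whisker u v g)).

Lemma equicoherent_sym u v f g : equicoherent u v f g -> equicoherent u v g f.
Proof. by move/boundaryN; rewrite opprB. Qed.

Lemma coherent_lact u v a g m : is_mono1 g -> src1 g = mon K m ->
  (forall m', m' \in supp a -> succX w (mmul (mmul u (mmul m' m)) v)) ->
  coherent (whisker u v (a *> g)).
Proof.
move=> gm sg below.
apply: (supp_ind (P := fun b => coherent (whisker u v (b *> g))))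
  => [b c|c b|m' /below below'|].
- by rewrite lactDl whiskerD; apply: coherentD.
- by rewrite lactZl whiskerZ; apply: coherentZ.
- rewrite whisker_lact_mon; apply: coh_below below' _ _ _.
    exact: mono1_whisker.
  by rewrite src1_whisker sg whisker_mon !mulmA.
- rewrite -(scale0r (0 : A)) lactZl whiskerZ scale0r -(scale0r (0 : cell1 X)).
  by rewrite defectZ scale0r; apply: Subbimod_0.
Qed.

Lemma coherent_ract u v a f m : is_mono1 f -> src1 f = mon K m ->
  (forall m', m' \in supp a -> succX w (mmul (mmul u (mmul m m')) v)) ->
  coherent (whisker u v (f <* a)).
Proof.
move=> fm sf below.
apply: (supp_ind (P := fun b => coherent (whisker u v (f <* b))))
  => [b c|c b|m' /below below'|].
- by rewrite ractDr whiskerD; apply: coherentD.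
- by rewrite ractZr whiskerZ; apply: coherentZ.
- rewrite whisker_ract_mon; apply: coh_below below' _ _ _.
    exact: mono1_whisker.
  by rewrite src1_whisker sf whisker_mon !mulmA.
- rewrite -(scale0r (0 : A)) ractZr whiskerZ scale0r -(scale0r (0 : cell1 X)).
  by rewrite defectZ scale0r; apply: Subbimod_0.
Qed.

(** For f = f1 v1 and g = u1 g1, the interchange relation reads, up to
    identities, f + t(f1) g1 = g + f1 t(g1), and t(f1) v1 and u1 t(g1) only
    involve monomials smaller than u1 v1. *)
Lemma peiffer_equicoherent u v m f g : peiffer f g ->
  src1 f = mon K m -> mmul (mmul u m) v = w -> equicoherent u v f g.
Proof.
case=> u1 [v1 [f1 [g1 [[f1m g1m] sf1 sg1 -> ->]]]].
have [_ _ ->] := src1_bimod_morphism X; rewrite sf1.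
rewrite -[mon K u1 <* _]/(mon K u1 * mon K v1) -monM => /mon_inj <- uvw.
have tgt_below m' : m' \in supp (tgt1 f1) ->
    succX w (mmul (mmul u (mmul m' v1)) v).
  move=> m't; rewrite -uvw; apply: SuccX_mul.
  rewrite -[mmul u1 _]mul1m -[mmul m' _]mul1m !mulmA.
  exact/SuccX_mul/(mono1_succ leftX f1m sf1 m't).
have tgt_below' m' : m' \in supp (tgt1 g1) ->
    succX w (mmul (mmul u (mmul u1 m')) v).
  move=> m't; rewrite -uvw; apply: SuccX_mul.
  rewrite -[mmul u1 v1]mulm1 -[mmul u1 m']mulm1.
  exact/SuccX_mul/(mono1_succ leftX g1m sg1 m't).
have := congr1 (fun z => D (whisker u v z)) (interchange1 f1 g1).
rewrite sf1 sg1 !defect_whisker_subid !whiskerD !defectD => /addr_eq_subr eqD.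
rewrite /equicoherent eqD.
apply: boundaryB.
  exact: coherent_ract tgt_below'.
exact: coherent_lact tgt_below.
Qed.

(** The 2-cell y makes (f followed by h) - (g followed by k) a boundary with
    zero source and target, hence equal to its own defect; h and k start from
    t(f) and t(g), so they are coherent by induction. *)
Lemma critical_equicoherent u v f g (y : gen2 Y) : filled_by f g y ->
  src1 f = src1 g ->
  (forall m', m' \in supp (tgt1 f) -> succX w (mmul (mmul u m') v)) ->
  (forall m', m' \in supp (tgt1 g) -> succX w (mmul (mmul u m') v)) ->
  equicoherent u v f g.
Proof.
case=> h [k [[hp kp sh sk hk] sy ty]] fg belowf belowg.
have By : boundary Y (comp1 f h - comp1 g k).
  by apply: Subbimod_gen; exists y; rewrite sy ty.
have src0 : src1 (comp1 f h - comp1 g k) = 0.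
  by rewrite src1B !src1_comp ?fg ?subrr.
have tgt0 : tgt1 (comp1 f h - comp1 g k) = 0.
  by rewrite tgt1B !tgt1_comp hk subrr.
have := boundary_whisker u v By.
rewrite -[whisker _ _ _](defect_loop phi); first last.
- by rewrite tgt1_whisker tgt0 whisker0.
- by rewrite src1_whisker src0 whisker0.
rewrite whiskerB defectB !defect_whisker_comp => Bfg.
(* Reads D(f) - D(g) as (D(f) + D(h) - (D(g) + D(k))) - (D(h) - D(k)). *)
rewrite /equicoherent -[X in boundary Y X](addrK
  (D (whisker u v h) - D (whisker u v k))) addrACA -opprD.
apply: boundaryB Bfg (boundaryB _ _); apply: coherent_positive => //.
  by rewrite sh.
by rewrite sk.
Qed.

Lemma equicoherent_trans u v f g h :
  equicoherent u v f g -> equicoherent u v g h -> equicoherent u v f h.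
Proof. by move=> fg /(Subbimod_D fg); rewrite addrA subrK. Qed.

(** Only the first step of p matters: what follows it starts from monomials
    smaller than w, hence is coherent. *)
Lemma positive_equicoherent u v m p : positive p -> src1 p = mon K m ->
  tgt1 p <> src1 p -> mmul (mmul u m) v = w ->
  exists f, [/\ is_mono1 f, src1 f = mon K m & equicoherent u v p f].
Proof.
move=> pp sp tp uvw; have [pE|[f [h [fm sf hp fh pE]]]] := positive_src_mon pp sp.
  by case: tp; rewrite pE tgt1_id1 src1_id1.
exists f; split=> //; rewrite /equicoherent pE defect_whisker_comp addrAC subrr.
rewrite add0r; apply: coherent_positive => // m'; rewrite -fh -uvw => m't.
exact/SuccX_mul/(mono1_succ leftX fm sf m't).
Qed.

Context (cellsY : contains_critical_cells Y).

(** Induction on the length of the overlap m, with the context u, v free: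
    a decomposition of the pair moves letters from m into the context. *)
Lemma local_equicoherent u v m f g : is_mono1 f -> is_mono1 g ->
  src1 f = mon K m -> src1 g = mon K m -> mmul (mmul u m) v = w ->
  equicoherent u v f g.
Proof.
have [n] := ubnP (size m); elim: n u v m f g => // n IH u v m f g ltmn.
move=> fm gm sf sg uvw.
have belowf m' : m' \in supp (tgt1 f) -> succX w (mmul (mmul u m') v).
  by move=> m't; rewrite -uvw; apply/SuccX_mul/(mono1_succ leftX fm sf m't).
have belowg m' : m' \in supp (tgt1 g) -> succX w (mmul (mmul u m') v).
  by move=> m't; rewrite -uvw; apply/SuccX_mul/(mono1_succ leftX gm sg m't).
have [->|neqfg] := pselect (f = g).
  by rewrite /equicoherent subrr; apply: Subbimod_0.
have [Pfg|notPfg] := pselect (peiffer f g).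
  exact: peiffer_equicoherent Pfg sf uvw.
have [Pgf|notPgf] := pselect (peiffer g f).
  exact/equicoherent_sym/(peiffer_equicoherent Pgf sg uvw).
have [|notdec] := pselect (decomposable f g); last first.
  have [|y [Fy|Fy]] := cellsY (f := f) (g := g).
  - by split; split; rewrite ?sf.
  - by apply: critical_equicoherent Fy _ _ _; rewrite ?sf ?sg.
  - apply/equicoherent_sym.
    by apply: critical_equicoherent Fy _ _ _; rewrite ?sf ?sg.
case=> u1 [v1 [f' [g' [[f'p g'p sfg] notone fE gE]]]].
have sf' : whisker u1 v1 (src1 f') = mon K m by rewrite -src1_whisker -sf fE.
have [m1 mE {}sf'] := whisker_eq_mon sf'.
have sg' : src1 g' = mon K m1 by rewrite -sfg.
have uvw1 : mmul (mmul (mmul u u1) m1) (mmul v1 v) = w.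
  by rewrite -uvw mE !mulmA.
have tf' : tgt1 f' <> src1 f'.
  move=> eqf; apply: (mono1_tgt_neq_src leftX fm).
  by rewrite fE tgt1_whisker src1_whisker eqf.
have tg' : tgt1 g' <> src1 g'.
  move=> eqg; apply: (mono1_tgt_neq_src leftX gm).
  by rewrite gE tgt1_whisker src1_whisker eqg.
have [f1 [f1m sf1 ff1]] := positive_equicoherent f'p sf' tf' uvw1.
have [g1 [g1m sg1 gg1]] := positive_equicoherent g'p sg' tg' uvw1.
have ltm1 : (size m1 < n)%N.
  rewrite -ltnS (leq_trans _ ltmn) // ltnS mE !mmul_val !size_cat.
  case: (posnP (size u1 + size v1)) => [/eqP|]; last first.
    by rewrite -(ltn_add2r (size m1)) add0n addnAC.
  rewrite addn_eq0 !size_eq0 => /andP[/eqP u10 /eqP v10]; case: notone.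
  by split; apply: val_inj; rewrite /= ?u10 ?v10 fm1.
have := IH _ _ _ _ _ ltm1 f1m g1m sf1 sg1 uvw1.
move/(equicoherent_trans ff1) => /equicoherent_trans/(_ (equicoherent_sym gg1)).
by rewrite /equicoherent -!whiskerA fE gE.
Qed.

End Below.

(** The chosen 1-monomial e has defect zero by the equation defining phi, so
    comparing f with e in the empty context suffices. *)
Lemma mono1_coherent : terminating X -> contains_critical_cells Y ->
  (forall w f, is_mono1 f -> src1 f = mon K w ->
     exists e, [/\ is_mono1 e, src1 e = mon K w &
       phi w = e - id1 (src1 e) + linext phi (tgt1 e)]) ->
  forall f, is_mono1 f -> coherent f.
Proof.
move=> wf cellsY phiE f fm; have [w sf] := mono1_src leftX fm.
elim/(well_founded_ind wf): w f fm sf => w IH f fm sf.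
have [e [em se phiw]] := phiE w f fm sf.
have De : D e = 0 by rewrite /defect -phiw se linextU subrr.
have := local_equicoherent (u := mone) (v := mone) IH cellsY fm em sf se.
by rewrite /equicoherent !whisker_one De subr0 mul1m mulm1; apply.
Qed.

End Squier.

Theorem theorem4p3p2 (K : fieldType) (X : polygraph1 K)
    (Y : cellular_extension X) :
  left_monomial X -> convergent X -> contains_critical_cells Y -> acyclic Y.
Proof.
move=> leftX [wf _] cellsY; have [phi phiE] := reduction_exists leftX wf.
apply: acyclic_boundary => z sz tz; rewrite -(defect_loop phi sz tz).
elim/cell1_ind: z {sz tz} => [f fm|a|f g Bf Bg|c f Bf].
- exact: mono1_coherent phiE f fm.
- exact: coherent_id1.
- exact: coherentD.
- exact: coherentZ.
Qed.
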